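(* Let $f:[0,1]\to\mathbb{R}$ be an absolutely continuous function such that $f'\in L_2(0,1)$. Then $$|Q(f;0,1)|\le\sqrt{\frac{11}{96}-\frac{\sqrt2}{16}}\;\sigma(f';0,1).$$ This inequality is sharp in the sense that the constant $\sqrt{\frac{11}{96}-\frac{\sqrt2}{16}}$ cannot be replaced by a smaller one (i.e. by a smaller constant for which the inequality would still hold for all such $f$).
   Context: For $f$ on $[0,1]$, $$Q(f;0,1)=\int_0^1 f(t)\,dt-\left[\frac{\sqrt2}{8}f(0)+\left(1-\frac{\sqrt2}{4}\right)f\left(\tfrac12\right)+\frac{\sqrt2}{8}f(1)\right].$$ For real-valued $g\in L_2(a,b)$, $\sigma(g;a,b)=\sqrt{(b-a)\,T(g,g)}$, where $T(g,g)=\frac1{b-a}\int_a^b g(t)^2\,dt-\left(\frac1{b-a}\int_a^b g(t)\,dt\right)^2$. In particular $\sigma(g;0,1)=\left(\int_0^1 g(t)^2\,dt-\left(\int_0^1 g(t)\,dt\right)^2\right)^{1/2}$. *)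

(* Defs.v *)
From mathcomp Require Import all_boot all_order all_algebra.
From mathcomp Require Import all_classical all_reals all_analysis.

Set Implicit Arguments.
Unset Strict Implicit.
Unset Printing Implicit Defensive.

Import Order.TTheory GRing.Theory Num.Theory.
Import numFieldNormedType.Exports.

Local Open Scope classical_set_scope.
Local Open Scope ring_scope.

(* A function on [a, b] is represented by an arbitrary extension to R; none of
   the notions below depends on its values outside [a, b]. *)

Definition abs_continuous {R : realType} (a b : R) (f : R -> R) : Prop :=
  forall e : R, 0 < e -> exists2 d : R, 0 < d &
    forall (n : nat) (u v : 'I_n -> R),
      (forall i, a <= u i /\ u i < v i /\ v i <= b) ->
      trivIset setT (fun i => `]u i, v i[%classic) ->
      \sum_(i < n) (v i - u i) < d ->
      \sum_(i < n) `|f (v i) - f (u i)| < e.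

(* L_2(a, b) is the set of functions whose extension by 0 is in L_2(R).  It is
   applied to the total function [f^`()], which has a junk value where [f] is
   not differentiable: for [f] absolutely continuous on [a, b] this concerns
   only a null subset of ]a, b[, and the endpoints are left out since [f^`()]
   is a two-sided derivative. *)
Definition L2 {R : realType} (a b : R) (g : R -> R) : Prop :=
  g \_ `]a, b[ \in Lfun (@lebesgue_measure R) 2%:E.

Definition Tdiag {R : realType} (a b : R) (g : R -> R) : R :=
  (b - a)^-1 * (\int[@lebesgue_measure R]_(t in `]a, b[) (g t ^+ 2))
  - ((b - a)^-1 * (\int[@lebesgue_measure R]_(t in `]a, b[) g t)) ^+ 2.

Definition sigma {R : realType} (a b : R) (g : R -> R) : R :=
  Num.sqrt ((b - a) * Tdiag a b g).

Definition Q01 {R : realType} (f : R -> R) : R :=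
  \int[@lebesgue_measure R]_(t in `[0, 1]) f t
  - (Num.sqrt 2 / 8 * f 0 + (1 - Num.sqrt 2 / 4) * f (1 / 2)
     + Num.sqrt 2 / 8 * f 1).

(* Main.v *)
Require Import Defs.
From HB Require Import structures.
From mathcomp Require Import all_boot all_order all_algebra finmap.
From mathcomp Require Import all_classical all_reals all_analysis.
From mathcomp Require Import measurable_realfun ring lra.

(**
Write c = sqrt 2 / 8, so that the quadrature rule is the symmetric three-point
rule with weights c, 1 - 2c, c.  Its error is represented by its Peano kernel
K, equal to s - c on the left half of [0, 1] and to s - (1 - c) on the right
half:

  Q(f) = - int_0^1 K(s) f'(s) ds        (three_point_peano).

Up to its value at 1/2, K is odd about that point, so it has mean zero and f'
may be replaced in this integral by f' minus its mean; the Cauchy-Schwarz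
inequality then gives
|Q(f)| <= ||K||_2 sigma(f')  (three_point_bound), and a direct computation
gives ||K||_2^2 = 1/12 - c/2 + c^2 = 11/96 - sqrt 2 / 16.  Equality holds when
f' is proportional to K.  A primitive of K is absolutely continuous, and its
error is -||K||_2^2 while its sigma is ||K||_2 (peano_extremal_equality); since
K is nonzero, no smaller constant can work.

The analytic content is the fundamental theorem of calculus for absolutely
continuous functions (abs_continuous_FTC): such an f has an integrable density
g with f(x) - f(a) = int_a^x g, and the pointwise derivative of f equals g
almost everywhere.  The density comes from the Radon-Nikodym theorem.  The
total variation V of f is again absolutely continuous, and both V and V - f are
nondecreasing, so f = V - (V - f) reduces the question to a nondecreasing
absolutely continuous G.  The Lebesgue-Stieltjes measure of G vanishes on
Lebesgue null sets: a null set is covered by half-open intervals of small total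
length, and finite unions of these can be rewritten as disjoint unions, to
which the definition of absolute continuity applies.  Lebesgue's
differentiation theorem then identifies the density with the derivative.  The
kernel representation follows from f = f(0) + int_0^x g by exchanging the order
of integration in the iterated integral of g (integral_iterated).
*)

Set Implicit Arguments.
Unset Strict Implicit.
Unset Printing Implicit Defensive.

Import Order.TTheory GRing.Theory Num.Theory.
Import numFieldNormedType.Exports.

Local Open Scope classical_set_scope.
Local Open Scope ring_scope.

Local Notation mu := lebesgue_measure.

(** * Total variation of absolutely continuous functions *)

(** Intervals obtained by subdividing those of a given family, or by clamping
    their endpoints, are naturally indexed by other finite types than an initial
    segment and may be degenerate; degenerate ones contribute nothing and are
    filtered out. *)
Lemma abs_continuous_fin {R : realType} (a b : R) (f : R -> R) :
  abs_continuous a b f -> forall e : R, 0 < e -> exists2 d : R, 0 < d &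
    forall (I : finType) (u v : I -> R),
      (forall i, a <= u i /\ u i <= v i /\ v i <= b) ->
      trivIset setT (fun i => `]u i, v i[%classic) ->
      \sum_i (v i - u i) < d ->
      \sum_i `|f (v i) - f (u i)| < e.
Proof.
move=> fac e /fac[d d0 fd]; exists d => // I u v uv tuv sd.
pose P := [pred i | u i < v i].
have reidx (F : I -> R) : (forall i, u i = v i -> F i = 0) ->
    \sum_i F i = \sum_(k < #|P|) F (enum_val k).
  move=> F0; rewrite -(big_enum_val F) [LHS](bigID (mem P))/= [X in _ + X]big1 ?addr0 => [|i].
    by [].
  rewrite !inE -leNgt => vu; apply: F0; apply/eqP.
  by rewrite eq_le vu (uv i).2.1.
rewrite reidx => [|i ->]; last by rewrite subrr normr0.
apply: fd => [k||].
- have [? [_ ?]] := uv (enum_val k); split=> //; split=> //.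
  by have := enum_valP k; rewrite inE.
- apply/trivIsetP => j k _ _ jk; move/trivIsetP : tuv; apply => //.
  by apply: contra_neq jk => /enum_val_inj.
- by rewrite -(reidx (fun i => v i - u i))// => i ->; rewrite subrr.
Qed.

(** Subdividing each interval of a disjoint family leaves the total length
    unchanged and the pieces disjoint, so the same modulus d serves for all
    subdivisions at once. *)
Lemma sum_variation_lt {R : realType} (a b : R) (f : R -> R) :
  abs_continuous a b f -> forall e : R, 0 < e -> exists2 d : R, 0 < d &
    forall (n : nat) (u v : 'I_n -> R) (s : 'I_n -> seq R),
      (forall i, a <= u i /\ u i < v i /\ v i <= b) ->
      trivIset setT (fun i => `]u i, v i[%classic) ->
      \sum_(i < n) (v i - u i) < d ->
      (forall i, itv_partition (u i) (v i) (s i)) ->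
      \sum_(i < n) variation (u i) (v i) f (s i) < e.
Proof.
move=> /abs_continuous_fin fac e /fac[d d0 fd].
exists d => // n u v s uv tuv sd sp.
(* x i m is the m-th subdivision point of the i-th interval, x i 0 being u i. *)
pose x i m := nth (v i) (u i :: s i) m.
pose I := {i : 'I_n & 'I_(size (s i))}.
have xmono i (m p : nat) : (m <= p)%N -> (p <= size (s i))%N -> x i m <= x i p.
  elim: p => [|p IH]; first by rewrite leqn0 => /eqP ->.
  rewrite leq_eqVlt => /predU1P[->//|mp] ps.
  apply: (le_trans (IH mp (ltnW ps))).
  by have /= := @nondecreasing_fun_itv_partition _ _ _ _ id _ _ (sp i); apply.
have sumE (F : forall i : 'I_n, nat -> R) :
    \sum_(i < n) \sum_(0 <= k < size (s i)) F i k =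
    \sum_(k : I) F (tag k) (tagged k).
  rewrite (eq_bigr (fun i => \sum_(k < size (s i)) F i k)) => [|i _]; last first.
    by rewrite big_mkord.
  by rewrite sig_big_dep.
rewrite /variation.
have -> : \sum_(i < n) \sum_(0 <= k < size (s i))
   `|(f \o x i) k.+1 - (f \o x i) k| = \sum_(k : I)
   `|f (x (tag k) (tagged k).+1) - f (x (tag k) (tagged k))|.
  by rewrite (sumE (fun i k => `|(f \o x i) k.+1 - (f \o x i) k|)).
have xle i (m : nat) : (m <= size (s i))%N -> u i <= x i m <= v i.
  move=> ms; rewrite (itv_partition_nth_ge _ (sp i))//.
  by rewrite (itv_partition_nth_le _ (sp i)).
apply: fd => [k||].
- case: k => i k /=; have [? [_ ?]] := uv i.
  have /andP[? _] := xle i k (ltnW (ltn_ord k)).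
  have /andP[_ ?] := xle i k.+1 (ltn_ord k).
  split; first exact: (le_trans _ (_ : u i <= _)).
  by split; [exact: xmono|exact: (le_trans (_ : _ <= v i))].
- apply/trivIsetP => -[i k] [j l] _ _ /= ijkl.
  have [ij|ij] := eqVneq i j; last first.
    move/trivIsetP : tuv => /(_ i j Logic.I Logic.I ij); apply: subsetI_eq0.
      apply: subset_itv; rewrite bnd_simp.
        by have /andP[] := xle i k (ltnW (ltn_ord k)).
      by have /andP[] := xle i k.+1 (ltn_ord k).
    apply: subset_itv; rewrite bnd_simp.
      by have /andP[] := xle j l (ltnW (ltn_ord l)).
    by have /andP[] := xle j l.+1 (ltn_ord l).
  subst j; have {ijkl} kl : (k != l :> nat).
    by apply: contra_neq ijkl => kl; congr existT; exact/val_inj.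
  rewrite -subset0 => z [] /=; rewrite !in_itv/= => /andP[z1 z2] /andP[z3 z4].
  move: kl; rewrite neq_ltn => /orP[kl|kl].
    have := xmono i k.+1 l kl (ltnW (ltn_ord l)).
    by rewrite leNgt (lt_trans z3 z2).
  have := xmono i l.+1 k kl (ltnW (ltn_ord k)).
  by rewrite leNgt (lt_trans z1 z4).
- rewrite -(sumE (fun i k => x i k.+1 - x i k)).
  rewrite (eq_bigr (fun i => v i - u i)) // => i _.
  by rewrite telescope_sumr// /x (itv_partition_nth_size _ (sp i)).
Qed.

Lemma total_variation_small {R : realType} (a b : R) (f : R -> R) :
  abs_continuous a b f -> forall e : R, 0 < e -> exists2 d : R, 0 < d &
    forall u v, a <= u -> u <= v -> v <= b -> v - u < d ->
      (total_variation u v f <= e%:E)%E.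
Proof.
move=> /sum_variation_lt fac e e0; have [d d0 fd] := fac e e0.
exists d => // u v au; rewrite le_eqVlt => /predU1P[<-|uv] vb vud.
  by rewrite total_variationxx lee_fin ltW.
apply: ge_ereal_sup => _ [_ [s sp <-] <-]; rewrite lee_fin ltW//.
have := fd 1%N (fun=> u) (fun=> v) (fun=> s); rewrite !big_ord1; apply => //.
by apply/trivIsetP => i j _ _; rewrite !ord1 eqxx.
Qed.

(** The variation is at most 1 on every interval shorter than some d, and
    finitely many steps of length d / 2 cover [a, b]. *)
Lemma abs_continuous_bounded_variation {R : realType} (a b : R) (f : R -> R) :
  a <= b -> abs_continuous a b f -> bounded_variation a b f.
Proof.
move=> ab /total_variation_small /(_ 1 ltr01)[d d0 fd].
apply/bounded_variationP => //.
(* Steps of d / 2 rather than d, the bound on lengths being strict. *)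
suff H (k : nat) : forall x, a <= x -> x <= b -> x - a < (d / 2) *+ k ->
    total_variation a x f \is a fin_num.
  apply: (H (Num.bound ((b - a) / (d / 2)))) => //.
  rewrite -mulr_natr -ltr_pdivrMl ?divr_gt0// mulrC.
  by rewrite archi_boundP// divr_ge0 ?subr_ge0// divr_ge0// ltW.
elim: k => [|k IH] x ax xb xk.
  by move: xk; rewrite mulr0n subr_lt0 ltNge ax.
pose y := Num.max a (x - d / 2).
have ay : a <= y by rewrite le_max lexx.
have yx : y <= x by rewrite ge_max ax lerBlDr lerDl divr_ge0 ?(ltW d0).
rewrite (total_variationD f ay yx) fin_numD; apply/andP; split; last first.
  rewrite ge0_fin_numE ?total_variation_ge0// (le_lt_trans (fd _ _ _ _ _ _)) ?ltry//.
  rewrite ltrBlDr -ltrBlDl lt_max ltrD2l ltrN2 gtr_pMr// invf_lt1//.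
  by rewrite ltr1n orbT.
have [xa|xa] := leP (x - d / 2) a.
  by rewrite /y (max_idPl xa) total_variationxx.
rewrite /y (max_idPr (ltW xa)); apply: IH => //; first exact: ltW.
  by apply: le_trans xb; rewrite lerBlDr lerDl divr_ge0 ?(ltW d0).
by rewrite addrAC ltrBlDr -mulrSr.
Qed.

(** The increment of the total variation over an interval is approached, up to
    an error that is small when summed over the family, by the variation along
    one partition of that interval; sum_variation_lt bounds these together. *)
Lemma total_variation_abs_continuous {R : realType} (a b : R) (f : R -> R) :
  a <= b -> abs_continuous a b f ->
  abs_continuous a b (fun x => fine (total_variation a x f)).
Proof.
move=> ab fac e e0; have /bounded_variationP := abs_continuous_bounded_variation ab fac.
move=> /(_ ab) TVab.
have TVfin u v : a <= u -> u <= v -> v <= b -> total_variation u v f \is a fin_num.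
  move=> au uv vb; have ub := le_trans uv vb; have av := le_trans au uv.
  have := TVab; rewrite (total_variationD f au ub) fin_numD => /andP[_].
  by rewrite (total_variationD f uv vb) fin_numD => /andP[].
have e20 : 0 < e / 2 by rewrite divr_gt0.
have [d d0 fd] := sum_variation_lt fac e20.
exists d => // n u v uv tuv suv.
(* n.+1 rather than n, which may be 0. *)
have e2n : 0 < e / 2 / n.+1%:R by rewrite divr_gt0.
have /choice[s sP] i : exists s, itv_partition (u i) (v i) s /\
    `|fine (total_variation a (v i) f) - fine (total_variation a (u i) f)| <=
      variation (u i) (v i) f s + e / 2 / n.+1%:R.
  have [au [/ltW ui vi]] := uv i.
  have [_ [_ [s sp <-] <-] sltv] :=
    ub_ereal_sup_adherent e2n (TVfin _ _ au ui vi).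
  exists s; split => //.
  rewrite (total_variationD f au ui) fineD ?TVfin ?(le_trans ui)//.
  rewrite addrAC subrr add0r ger0_norm ?fine_ge0 ?total_variation_ge0//.
  rewrite -lerBlDr -lee_fin EFinB fineK ?TVfin//; exact: ltW.
apply: (@le_lt_trans _ _ (\sum_(i < n) (variation (u i) (v i) f (s i) + e / 2 / n.+1%:R))).
  by apply: ler_sum => i _; have [] := sP i.
rewrite big_split/= [e in _ < e]splitr ltrD//.
  by apply: fd => // i; have [] := sP i.
rewrite sumr_const card_ord -[ltLHS]mulr_natr -[ltLHS]mulrA gtr_pMr// mulrC.
by rewrite ltr_pdivrMr// mul1r ltr_nat.
Qed.

(** * Absolutely continuous Lebesgue-Stieltjes measures *)

Lemma lebesgue_stieltjes_itvoc {R : realType} (G : cumulative R R) (x y : R) :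
  x <= y -> lebesgue_stieltjes_measure G `]x, y] = (G y - G x)%:E.
Proof.
move=> xy; rewrite /lebesgue_stieltjes_measure /measure_extension.
by rewrite measurable_mu_extE/= ?wlength_itv_bnd//; exact: is_ocitv.
Qed.

(** The epsilon-delta hypothesis only sees finite disjoint families, whereas a
    null set is covered by a sequence of possibly overlapping half-open
    intervals.  The gap is bridged by the ring of sets that these generate: a
    partial union of the cover is a finite disjoint union of half-open
    intervals, and continuity from below gives the bound for the whole cover. *)
Lemma lebesgue_stieltjes_dominated {R : realType} (G : cumulative R R) :
  (forall e : R, 0 < e -> exists2 d : R, 0 < d &
    forall (I : finType) (u v : I -> R), (forall i, u i <= v i) ->
      trivIset setT (fun i => `]u i, v i]%classic) ->
      \sum_i (v i - u i) < d -> \sum_i (G (v i) - G (u i)) <= e) ->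
  lebesgue_stieltjes_measure G `<< @lebesgue_measure R.
Proof.
move=> Gac; apply/null_content_dominatesP => A mA A0.
set nu := lebesgue_stieltjes_measure G.
apply/eqP; rewrite eq_le measure_ge0 andbT.
apply/lee_addgt0Pr => e /Gac[d d0 Gd]; rewrite add0e.
have : (@lebesgue_measure R A < d%:E)%E by rewrite A0 lte_fin.
move=> /ereal_inf_lt[_ [F [mF AF] <-] Fd].
have mF' k : measurable (F k : set R) by apply: sub_sigma_algebra; exact: mF.
pose B n := \big[setU/set0]_(k < n.+1) F k.
have mB n : measurable (B n : set R) by apply: bigsetU_measurable.
have UB : \bigcup_n F n = \bigcup_n B n by rewrite /B bigcup_bigsetU_bigcup.
apply: (@le_trans _ _ (nu (\bigcup_n F n))).
  by apply: le_measure; rewrite ?inE//; exact: bigcupT_measurable.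
have cB : nu (B n) @[n --> \oo] --> nu (\bigcup_n F n).
  rewrite UB; apply: nondecreasing_cvg_mu => //; first exact: bigcupT_measurable.
  by move=> m n mn; apply/subsetPset; apply: subset_bigsetU; rewrite ltnS.
rewrite -(cvg_lim _ cB)//; apply: lime_le; first by apply/cvg_ex; eexists; exact: cB.
apply: nearW => n.
have /SetRing.ring_finite_set[D [fD D0 tD mD BD]] :
    measurable (B n : set (SetRing.type (ocitv_type R))).
  by apply: bigsetU_measurable => k _; apply: sub_gen_smallest; exact: mF.
have nuB (H : cumulative R R) : lebesgue_stieltjes_measure H (B n) =
    (\sum_(X : fset_set D) lebesgue_stieltjes_measure H (val X))%E.
  rewrite -(big_seq_fsetE _ _ xpredT (lebesgue_stieltjes_measure H))/=.
  rewrite -fsbig_finite//= -measure_fin_bigcup//=.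
    by congr (_ _); rewrite BD.
  by move=> X DX; apply: sub_sigma_algebra; apply: mD; rewrite inE.
have /choice[p pP] (X : fset_set D) : exists p : R * R,
    p.1 <= p.2 /\ val X = `]p.1, p.2]%classic.
  have XD : val X \in D by have := valP X; rewrite in_fset_set.
  have /ocitvP[X0|[p /ltW p12 ->]] := mD _ XD; last by exists p.
  by move: XD; rewrite inE => /D0[x]; rewrite X0.
have nuE (H : cumulative R R) : lebesgue_stieltjes_measure H (B n) =
    (\sum_(X : fset_set D) (H (p X).2 - H (p X).1))%:E.
  rewrite nuB -sumEFin; apply: eq_bigr => X _.
  by have [p12 ->] := pP X; rewrite lebesgue_stieltjes_itvoc.
rewrite [leLHS]nuE lee_fin; apply: Gd => [X||].
- by have [] := pP X.
- apply/trivIsetP => X Y _ _ XY; have [_ <-] := pP X; have [_ <-] := pP Y.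
  move/trivIsetP : tD; apply.
  + by have := valP X; rewrite in_fset_set// inE.
  + by have := valP Y; rewrite in_fset_set// inE.
  + by apply: contra_neq XY => /val_inj.
- rewrite -lte_fin -(nuE (@idfun R)) (le_lt_trans _ Fd)//.
  have : (@lebesgue_measure R (B n) <= \sum_(k < n.+1) @lebesgue_measure R (F k))%E.
    by apply: content_subadditive => //; [move=> k _; exact: mF'|exact: mB].
  move=> /le_trans; apply.
  rewrite (eq_bigr (fun k : 'I_n.+1 => wlength idfun (F k))) => [|k _].
    rewrite -(big_mkord xpredT (fun k => wlength idfun (F k))).
    by apply: nneseries_lim_ge => k _ _; exact: wlength_ge0.
  rewrite /lebesgue_measure /lebesgue_stieltjes_measure /measure_extension.
  by rewrite measurable_mu_extE.
Qed.

(** Composing with the projection onto [a, b] extends a function on [a, b] to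
    the whole line without creating new increments, as is needed to see it as
    the cumulative function of a measure. *)
Definition clamp {R : realType} (a b x : R) := Num.max a (Num.min x b).

Lemma clamp_id {R : realType} (a b x : R) : a <= x -> x <= b -> clamp a b x = x.
Proof. by move=> ax xb; rewrite /clamp (min_idPl xb) (max_idPr ax). Qed.

Lemma clamp_itv {R : realType} (a b x : R) : a <= b -> a <= clamp a b x <= b.
Proof. by move=> ab; rewrite le_max lexx ge_max ab/= ge_min lexx orbT. Qed.

Lemma clamp_homo {R : realType} (a b : R) :
  {homo clamp a b : x y / x <= y}.
Proof.
move=> x y xy; rewrite /clamp !maxEle !minEle.
by repeat case: ifPn; rewrite -?ltNge => *; lra.
Qed.

Lemma clampB_le {R : realType} (a b x y : R) : x <= y ->
  clamp a b y - clamp a b x <= y - x.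
Proof.
rewrite /clamp => xy; rewrite !maxEle !minEle.
by repeat case: ifPn; rewrite -?ltNge => *; lra.
Qed.

(** Clamping does not expand intervals, hence preserves disjointness. *)
Lemma clamp_sub_itv {R : realType} (a b x y : R) :
  `]clamp a b x, clamp a b y[ `<=` `]x, y].
Proof.
move=> z /=; rewrite !in_itv/= /clamp gt_max !lt_max => /andP[/andP[az +]].
rewrite gt_min lt_min => xz /orP[za|/andP[zy zb]].
  by have := lt_trans az za; rewrite ltxx.
rewrite (ltW zy) andbT; case/orP : xz => // bz.
by have := lt_trans zb bz; rewrite ltxx.
Qed.

(** Radon-Nikodym applied to the Lebesgue-Stieltjes measure of the clamped
    extension of G, cut down to ]a, b] to make it finite. *)
Lemma nondecreasing_abs_continuous_density {R : realType} (a b : R) (G : R -> R) :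
  a <= b -> {in `[a, b] &, {homo G : x y / x <= y}} -> abs_continuous a b G ->
  exists2 g : R -> R, mu.-integrable setT (EFin \o g) &
    forall x, a <= x <= b ->
      G x - G a = \int[@lebesgue_measure R]_(t in `]a, x]) g t.
Proof.
move=> ab Gnd /abs_continuous_fin Gac.
pose H x := G (clamp a b x).
have Hnd : {homo H : x y / x <= y}.
  move=> x y xy; apply: Gnd; rewrite ?in_itv/= ?clamp_itv//.
  exact: clamp_homo.
have Hac : forall e : R, 0 < e -> exists2 d : R, 0 < d &
    forall (I : finType) (u v : I -> R), (forall i, u i <= v i) ->
      trivIset setT (fun i => `]u i, v i]%classic) ->
      \sum_i (v i - u i) < d -> \sum_i (H (v i) - H (u i)) <= e.
  move=> e /Gac[d d0 Gd]; exists d => // I u v uv tuv suv.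
  apply/ltW/(le_lt_trans _ (Gd I (clamp a b \o u) (clamp a b \o v) _ _ _)).
  - by apply: ler_sum => i _; exact: ler_norm.
  - move=> i /=; split; first by have /andP[] := clamp_itv (u i) ab.
    by split; [exact: clamp_homo|have /andP[] := clamp_itv (v i) ab].
  - apply/trivIsetP => i j _ _ ij; move/trivIsetP : tuv => /(_ i j Logic.I Logic.I ij).
    by apply: subsetI_eq0; exact: clamp_sub_itv.
  - by apply: le_lt_trans suv; apply: ler_sum => i _; exact: clampB_le.
have Hrc : right_continuous H.
  move=> x; apply/cvgrPdist_le => e e0; have [d d0 Hd] := Hac e e0.
  near=> y; rewrite distrC ger0_norm ?subr_ge0 ?Hnd//.
  have := Hd unit (fun=> x) (fun=> y); rewrite !big_const !card_unit/= !addr0.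
  apply => //; first by apply/trivIsetP => -[] [].
  by rewrite ltrBlDl; near: y; apply: nbhs_right_lt; rewrite ltrDl.
pose cH : cumulative R R := HB.pack H (isCumulative.Build R _ R H Hnd Hrc).
have nuE x : a <= x <= b -> lebesgue_stieltjes_measure cH `]a, x] = (G x - G a)%:E.
  move=> /andP[ax xb]; rewrite lebesgue_stieltjes_itvoc//= /H.
  by rewrite !clamp_id.
have mab : measurable (`]a, b] : set (measurableTypeR R)) by [].
have nuy : (lebesgue_stieltjes_measure cH `]a, b] < +oo)%E.
  by rewrite nuE ?ab ?lexx// ltry.
have dom : mfrestr mab nuy `<< @lebesgue_measure R.
  apply/null_content_dominatesP => A mA A0; rewrite /mfrestr/= /mrestr.
  have /null_content_dominatesP dH := lebesgue_stieltjes_dominated Hac (G := cH).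
  apply/eqP; rewrite eq_le measure_ge0 andbT -(dH _ mA A0).
  by apply: le_measure; rewrite ?inE//; exact: measurableI.
have [g [g0 gfin ig gE]] := radon_nikodym_sigma_finite dom.
have gK : (fun x => (fine (g x))%:E) = g by apply/funext => x; rewrite fineK.
exists (fine \o g); first by rewrite /comp gK.
move=> x /[dup] axb /andP[ax xb]; apply: EFin_inj; rewrite -nuE//.
rewrite /Rintegral fineK; last first.
  by rewrite /= gK; apply: integrable_fin_num => //; exact: integrableS ig.
rewrite /= gK -gE// /mfrestr/= /mrestr; congr (_ _).
rewrite setIidl//; exact: subset_itvl.
Unshelve. all: by end_near. Qed.

(** * The fundamental theorem of calculus for absolutely continuous functions *)

Lemma abs_continuousB {R : realType} (a b : R) (f g : R -> R) :
  abs_continuous a b f -> abs_continuous a b g -> abs_continuous a b (f \- g).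
Proof.
move=> fac gac e e0; have e20 : 0 < e / 2 by rewrite divr_gt0.
have [d d0 fd] := fac _ e20; have [d' d'0 gd] := gac _ e20.
exists (Num.min d d'); first by rewrite lt_min d0.
move=> n u v uv tuv; rewrite lt_min => /andP[sd sd'].
apply: (@le_lt_trans _ _ (\sum_(i < n) `|f (v i) - f (u i)| +
                          \sum_(i < n) `|g (v i) - g (u i)|)).
  rewrite -big_split/=; apply: ler_sum => i _.
  rewrite [X in `|X|](_ : _ = (f (v i) - f (u i)) - (g (v i) - g (u i))).
    exact: ler_normB.
  by rewrite /=; ring.
by rewrite [e]splitr ltrD// ?fd ?gd.
Qed.

(** With V the total variation of f from a, both V and V - f are nondecreasing
    and absolutely continuous, and f is their difference. *)
Lemma abs_continuous_integral {R : realType} (a b : R) (f : R -> R) :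
  a <= b -> abs_continuous a b f ->
  exists2 g : R -> R, mu.-integrable setT (EFin \o g) &
    forall x, a <= x <= b ->
      f x - f a = \int[@lebesgue_measure R]_(t in `]a, x]) g t.
Proof.
move=> ab fac; pose V x := fine (total_variation a x f).
have TVab : total_variation a b f \is a fin_num.
  by apply/bounded_variationP => //; exact: abs_continuous_bounded_variation.
have VB x y : a <= x -> x <= y -> y <= b -> `|f y - f x| <= V y - V x.
  move=> ax xy yb; have xb := le_trans xy yb; rewrite /V.
  move: TVab; rewrite (total_variationD f ax xb) fin_numD => /andP[TVax].
  rewrite (total_variationD f xy yb) fin_numD => /andP[TVxy _].
  rewrite (total_variationD f ax xy) fineD// addrAC subrr add0r.
  by rewrite -lee_fin fineK// total_variation_ge.
have Vac : abs_continuous a b V by exact: total_variation_abs_continuous.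
have [|g ig gE] := nondecreasing_abs_continuous_density ab _ Vac.
  move=> x y; rewrite !in_itv/= => /andP[ax _] /andP[_ yb] xy.
  by rewrite -subr_ge0 (le_trans _ (VB _ _ ax xy yb)).
have [|h ih hE] := nondecreasing_abs_continuous_density ab _ (abs_continuousB Vac fac).
  move=> x y; rewrite !in_itv/= => /andP[ax _] /andP[_ yb] xy.
  have := VB _ _ ax xy yb; have := ler_norm (f y - f x); lra.
exists (g \- h); first exact: (integrableB measurableT ig ih).
move=> x axb; have := gE x axb; have := hE x axb.
rewrite RintegralB//; [|exact: integrableS ig|exact: integrableS ih].
by move=> <- <- /=; ring.
Qed.

(** Lebesgue's differentiation theorem recovers the density as the derivative
    of the indefinite integral, which near an interior point differs from f by a
    constant. *)
Lemma abs_continuous_FTC {R : realType} (a b : R) (f : R -> R) :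
  a <= b -> abs_continuous a b f ->
  exists g : R -> R, [/\ mu.-integrable setT (EFin \o g),
    forall x, a <= x <= b ->
      f x - f a = \int[@lebesgue_measure R]_(t in `]a, x]) g t &
    {ae @lebesgue_measure R, forall x, x \in `]a, b[ -> (f^`())%classic x = g x}].
Proof.
move=> ab /(abs_continuous_integral ab)[g ig gE]; exists g; split=> //.
pose F y := \int[@lebesgue_measure R]_(t in `]a, y]) g t.
have : {ae @lebesgue_measure R, forall x : R, (BRight a < BRight x)%E ->
    derivable F x 1 /\ (F^`())%classic x = g x}.
  apply: (@FTC1 R g (BRight a)); first by move=> y; exact: integrableS ig.
  by have := integrable_locally measurableT ig; rewrite patch_setT.
apply: filterS; first exact: (ae_filter_ringOfSetsType lebesgue_measure).
move=> x Fx; rewrite in_itv/= => /andP[ax xb].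
have [|dF <-] := Fx; first by rewrite lte_fin.
have -> : (F^`())%classic x = ((fun y => F y + f a)^`())%classic x.
  rewrite !derive1E deriveD//.
  by rewrite derive_cst addr0.
rewrite !derive1E; apply: near_eq_derive.
near=> y; rewrite /F -gE ?subrK//; apply/andP; split.
  by apply/ltW; near: y; exact: lt_nbhsr.
by apply/ltW; near: y; exact: lt_nbhsl.
Unshelve. all: by end_near. Qed.

(** * Integration of primitives *)

Lemma le_bounded {R : realType} (D : set R) (k : R -> R) (M : R) :
  (forall x, D x -> `|k x| <= M) -> [bounded k x | x in D].
Proof.
by move=> kM; exists M; split; [exact: num_real|move=> x /ltW Mx y /kM/le_trans; apply].
Qed.

Lemma integrable_boundedM {R : realType} (D : set R) (k g : R -> R) (M : R) :
  measurable D -> measurable_fun D k -> (forall x, D x -> `|k x| <= M) ->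
  mu.-integrable D (EFin \o g) ->
  mu.-integrable D (EFin \o (fun x => k x * g x)).
Proof. by move=> mD mk kM; apply: integrableMr => //; exact: le_bounded kM. Qed.

Lemma integrable_bounded {R : realType} (D : set R) (k : R -> R) (M : R) :
  measurable D -> (mu D < +oo)%E -> measurable_fun D k ->
  (forall x, D x -> `|k x| <= M) -> mu.-integrable D (EFin \o k).
Proof.
by move=> mD Doo mk kM; apply: measurable_bounded_integrable => //; exact: le_bounded kM.
Qed.

(** Both sides are the integral of g(s) over the triangle a < s <= t <= b. *)
Lemma integral_iterated {R : realType} (a b : R) (g : R -> R) :
  mu.-integrable setT (EFin \o g) ->
  mu.-integrable `]a, b]
    (EFin \o (fun t => \int[mu]_(s in `]a, t]) g s)) /\
  \int[mu]_(t in `]a, b])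
    (\int[mu]_(s in `]a, t]) g s) =
  \int[mu]_(s in `]a, b]) ((b - s) * g s).
Proof.
move=> ig.
have /integrableP[/measurable_EFinP mg _] := ig.
(* The carrier is written measurableTypeR R so that its sigma-algebra is the one
   on which the Lebesgue measure, hence the product measure, is defined. *)
pose h (p : measurableTypeR R * measurableTypeR R) :=
  (if [&& a < (p.2 : R), (p.2 : R) <= p.1 & (p.1 : R) <= b] then g p.2 else 0)%:E.
have mh : measurable_fun setT h.
  apply/measurable_EFinP; apply: measurable_fun_ifT => //.
    apply: measurable_and; first exact: measurable_fun_ltr.
    by apply: measurable_and; exact: measurable_fun_ler.
  exact: measurableT_comp.
have inner (c s : R) : (\int[mu]_t
    ((if a < s <= b then c else 0) * \1_(`[s, b]%classic : set R) t)%:E =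
    (if a < s <= b then (b - s) * c else 0)%:E)%E.
  under eq_integral do rewrite EFinM.
  rewrite integralZl//; last exact: integrable_indic_itv.
  rewrite integral_indic// setIT/= lebesgue_measure_itv/= lte_fin.
  case: ifP => [/andP[_]|_]; last by rewrite mul0e.
  rewrite mulrC EFinM; case: ltgtP => // -> _.
  by rewrite subrr mule0.
have hs t s : h (t, s) =
    ((if a < s <= b then g s else 0) * \1_(`[s, b]%classic : set R) t)%:E.
  rewrite /h/= indicE mem_setE in_itv/=; congr (_%:E).
  have [tb|tb] := leP t b; rewrite ?andbF ?mulr0// !andbT.
  have [st|st] := leP s t; rewrite ?andbF ?mulr0// !andbT mulr1.
  by rewrite (le_trans st tb) andbT.
have ht t : (\int[mu]_s h (t, s) =
    ((fun t => (\int[mu]_(s in `]a, t]) g s)%:E) \_ `]a, b]) t)%E.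
  rewrite patchE mem_setE in_itv/= /Rintegral fineK; last first.
    by apply: integrable_fin_num => //; exact: integrableS ig.
  case: ifP => [/andP[at0 tb]|tab].
    rewrite [RHS]integral_mkcond; apply: eq_integral => s _.
    by rewrite /h/= tb andbT patchE mem_setE in_itv/=; case: ifP.
  under eq_integral => s _.
    rewrite /h/= (_ : [&& _ , _ & _] = false).
      over.
    apply: contraFF tab => /and3P[as0 st ->].
    by rewrite (lt_le_trans as0 st).
  by rewrite integral0.
have hI s : (\int[mu]_t h (t, s) =
    ((fun s => ((b - s) * g s)%:E) \_ `]a, b]) s)%E.
  under eq_integral do rewrite hs.
  by rewrite inner patchE mem_setE in_itv/=; case: ifP.
have igb : mu.-integrable `]a, b] (fun s => ((b - s) * g s)%:E).
  apply: (@integrable_boundedM _ _ _ _ (b - a)) => //.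
  - exact: measurable_funB.
  - move=> s /=; rewrite in_itv/= => /andP[as0 sb].
    by rewrite ger0_norm ?subr_ge0// lerD2l lerN2 ltW.
  - exact: integrableS ig.
have ih : (mu \x mu)%E.-integrable setT h.
  apply/(integrable21ltyP _ _ mh).
  have /integrableP[_] := igb; rewrite integral_mkcond; congr (_ < _)%E.
  apply: eq_integral => s _.
  under [RHS]eq_integral => t _.
    rewrite hs abse_EFin normrM (fun_if Num.norm) normr0 indicE normr_nat -indicE.
    over.
  rewrite inner patchE mem_setE in_itv/=; case: ifP => // /andP[_ sb].
  by rewrite normrM ger0_norm// subr_ge0.
split.
  apply/integrable_mkcond => //.
  by have := integrable_fubini_F ih; apply: eq_integrable => // t _; exact: ht.
congr fine; rewrite integral_mkcond [RHS]integral_mkcond.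
under eq_integral do rewrite -ht.
under [RHS]eq_integral do rewrite -hI.
exact: Fubini.
Qed.

(** * The Peano kernel of symmetric three-point rules *)

(** The kernel of the rule with weights c, 1 - 2c, c at 0, 1/2, 1: it has slope
    1, takes the value - c at 0 and c at 1, and jumps by 2c - 1 at 1/2. *)
Definition peano_kernel {R : realType} (c s : R) : R :=
  if s <= 1 / 2 then s - c else s - (1 - c).

Lemma measurable_peano_kernel {R : realType} (c : R) :
  measurable_fun setT (peano_kernel c).
Proof.
apply: measurable_fun_ifT; first exact: measurable_fun_ler.
  exact: measurable_funB.
exact: measurable_funB.
Qed.

Lemma peano_kernel_bounded {R : realType} (c s : R) :
  0 <= s <= 1 -> `|peano_kernel c s| <= 1 + `|c|.
Proof.
rewrite /peano_kernel => /andP[s0 s1]; have := ler_norm c; have := ler_norm (- c).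
rewrite normrN ler_norml; case: ifPn; rewrite -?ltNge => *; lra.
Qed.

Lemma Rintegral_oo_halves {R : realType} (h : R -> R) :
  mu.-integrable (`]0, 1]%classic : set R) (EFin \o h) ->
  \int[mu]_(s in `]0, 1[) h s =
  \int[mu]_(s in `]0, 1 / 2]) h s + \int[mu]_(s in `]1 / 2, 1]) h s.
Proof.
move=> ih; rewrite Rintegral_itv_bndo_bndc; last first.
  by apply: integrableS ih => //; apply: subset_itvl; rewrite bnd_simp.
apply/eqP; rewrite addrC -subr_eq; apply/eqP.
by rewrite Rintegral_itvB// bnd_simp; lra.
Qed.

Lemma is_derive_subrX {R : realType} (d : R) (n : nat) (x : R) :
  is_derive x 1 (fun s : R => (s - d) ^+ n.+1 / n.+1%:R) ((x - d) ^+ n).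
Proof.
rewrite (_ : (fun s => _) = n.+1%:R^-1 \*: ((id - cst d) ^+ n.+1)); last first.
  by apply/funext => s; rewrite mulrC !fctE.
apply: is_derive_eq.
rewrite !fctE subr0 scaler1 scalerA.
by rewrite mulVf ?pnatr_eq0// scale1r.
Qed.

Lemma Rintegral_subrX {R : realType} (a b d : R) (n : nat) : a < b ->
  \int[mu]_(s in `]a, b]) (s - d) ^+ n =
  ((b - d) ^+ n.+1 - (a - d) ^+ n.+1) / n.+1%:R.
Proof.
move=> ab.
have cX m : continuous (fun s : R => (s - d) ^+ m).
  move=> x; apply: (@continuous_comp _ _ _ (fun s => s - d) (fun s => s ^+ m)).
    by apply: continuousB; [exact: cvg_id|exact: cvg_cst].
  exact: exprn_continuous.
have iX : mu.-integrable `[a, b] (EFin \o (fun s => (s - d) ^+ n)).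
  apply: continuous_compact_integrable; first exact: segment_compact.
  exact: continuous_subspaceT.
have dF := @is_derive_subrX R d n.
have cF : continuous (fun s : R => (s - d) ^+ n.+1 / n.+1%:R).
  move=> x; apply: differentiable_continuous; apply/derivable1_diffP.
  by have [dFx _] := dF x; exact: dFx.
rewrite Rintegral_itv_obnd_cbnd; last first.
  by apply: integrableS iX => //; apply: subset_itv; rewrite bnd_simp.
rewrite /Rintegral (@continuous_FTC2 _ _ (fun s => (s - d) ^+ n.+1 / n.+1%:R))//=.
- by rewrite -mulrBl.
- exact: continuous_subspaceT.
- split.
  + by move=> x _; have [] := dF x.
  + apply: cvg_at_right_filter; exact: cF.
  + apply: cvg_at_left_filter; exact: cF.
- by move=> x _; rewrite derive1E; exact: derive_val.
Qed.

Definition three_point_error {R : realType} (c : R) (f : R -> R) : R :=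
  \int[mu]_(t in `[0, 1]) f t
    - (c * f 0 + (1 - 2 * c) * f (1 / 2) + c * f 1).

(** After integral_iterated the error is a combination of the integrals of g
    and of s g(s) over the two halves of [0, 1], and so is the kernel integral;
    the two combinations agree. *)
Lemma primitive_peano {R : realType} (c : R) (f g : R -> R) :
  mu.-integrable setT (EFin \o g) ->
  (forall x, 0 <= x <= 1 -> f x - f 0 = \int[mu]_(t in `]0, x]) g t) ->
  three_point_error c f =
  - \int[mu]_(s in `]0, 1[) (peano_kernel c s * g s).
Proof.
move=> ig fE; rewrite /three_point_error; have [iF FE] := integral_iterated 0 1 ig.
have iD (D : set R) : measurable D -> mu.-integrable D (EFin \o g).
  by move=> mD; exact: integrableS ig.
have isg (x y : R) : 0 <= x -> y <= 1 -> mu.-integrable `]x, y] (EFin \o (fun s => s * g s)).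
  move=> x0 y1; apply: (@integrable_boundedM _ _ _ _ 1) => //; last exact: iD.
  move=> s /=; rewrite in_itv/= => /andP[xs sy].
  by rewrite ger0_norm ?(le_trans sy)// (le_trans x0)// ltW.
have iKg : mu.-integrable (`]0, 1]%classic : set R) (EFin \o (fun s => peano_kernel c s * g s)).
  apply: (@integrable_boundedM _ _ _ _ (1 + `|c|)) => //; last exact: iD.
    by apply: measurable_funTS; exact: measurable_peano_kernel.
  move=> s /=; rewrite in_itv/= => /andP[s0 s1].
  by rewrite peano_kernel_bounded// ltW.
have lin (x y p q : R) : 0 <= x -> y <= 1 ->
    \int[mu]_(s in `]x, y]) ((p * s + q) * g s) =
    p * \int[mu]_(s in `]x, y]) (s * g s) + q * \int[mu]_(s in `]x, y]) g s.
  move=> x0 y1; under eq_Rintegral do rewrite mulrDl -mulrA.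
  rewrite RintegralD//; last 2 first.
  - exact: (integrableZl _ p (isg _ _ x0 y1)).
  - exact: (integrableZl _ q (iD `]x, y]%classic _)).
  rewrite RintegralZl//; last exact: isg.
  by rewrite RintegralZl//; exact: iD.
rewrite Rintegral_oo_halves//.
have -> : \int[mu]_(s in `]0, 1 / 2]) (peano_kernel c s * g s) =
    \int[mu]_(s in `]0, 1 / 2]) ((1 * s + (- c)) * g s).
  apply: eq_Rintegral => s; rewrite inE/= in_itv/= => /andP[_ s1].
  by rewrite /peano_kernel s1 mul1r.
have -> : \int[mu]_(s in `]1 / 2, 1]) (peano_kernel c s * g s) =
    \int[mu]_(s in `]1 / 2, 1]) ((1 * s + (c - 1)) * g s).
  apply: eq_Rintegral => s; rewrite inE/= in_itv/= => /andP[s1 _].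
  by rewrite /peano_kernel leNgt s1/= mul1r opprB.
have h12 : 1 / 2 <= (1 : R) by lra.
rewrite !lin//.
have halves (h : R -> R) : mu.-integrable `]0, 1] (EFin \o h) ->
    \int[mu]_(s in `]0, 1]) h s =
    \int[mu]_(s in `]0, 1 / 2]) h s + \int[mu]_(s in `]1 / 2, 1]) h s.
  move=> ih; rewrite -Rintegral_oo_halves// Rintegral_itv_bndo_bndc//.
  by apply: integrableS ih => //; apply: subset_itvl; rewrite bnd_simp.
have h01 : 0 <= (1 / 2 : R) <= 1 by apply/andP; split; lra.
have l01 : 0 <= (1 : R) <= 1 by rewrite ler01 lexx.
have f1 := fE _ l01; have fh := fE _ h01.
rewrite halves in f1; last exact: iD.
have If : \int[mu]_(t in `[0, 1]) f t = f 0 + \int[mu]_(s in `]0, 1]) ((1 - s) * g s).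
  have fF t : `]0, 1]%classic t ->
      f t = f 0 + \int[mu]_(s in `]0, t]) g s.
    rewrite /= in_itv/= => /andP[t0 t1].
    by rewrite -fE ?(ltW t0)//; ring.
  have ic : mu.-integrable (`]0, 1]%classic : set R) (EFin \o (fun=> f 0)).
    apply: (@integrable_bounded _ _ _ `|f 0|) => //.
    by rewrite lebesgue_measure_itv/= lte_fin ltr01 -EFinB ltry.
  have iff : mu.-integrable (`]0, 1]%classic : set R) (EFin \o f).
    have iS : mu.-integrable `]0, 1]
        (fun t => (f 0 + \int[mu]_(s in `]0, t]) g s)%:E).
      exact: integrableD ic iF.
    move: iS; apply: eq_integrable => //.
    by move=> t; rewrite inE => /fF /= ->.
  rewrite -Rintegral_itv_obnd_cbnd// -FE.
  under eq_Rintegral => t /[!inE]/fF -> do over.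
  rewrite RintegralD// Rintegral_cst//= lebesgue_measure_itv/= lte_fin ltr01.
  by rewrite -EFinB/= subr0 mulr1.
rewrite If (_ : \int[mu]_(s in `]0, 1]) ((1 - s) * g s) =
    \int[mu]_(s in `]0, 1]) ((-1 * s + 1) * g s)); last first.
  by apply: eq_Rintegral => s _; congr (_ * _); ring.
rewrite lin// !halves//; [|exact: iD|exact: isg].
move/eqP: f1; rewrite subr_eq => /eqP ->.
move/eqP: fh; rewrite subr_eq => /eqP ->.
by ring.
Qed.

Lemma integrable_peano_kernelX {R : realType} (c : R) (n : nat) :
  mu.-integrable (`]0, 1]%classic : set R) (EFin \o (fun s => peano_kernel c s ^+ n)).
Proof.
apply: (@integrable_bounded _ _ _ ((1 + `|c|) ^+ n)) => //.
- by rewrite /= lebesgue_measure_itv/= lte_fin ltr01 -EFinB ltry.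
- by apply: measurable_funX; apply: measurable_funTS; exact: measurable_peano_kernel.
- move=> s /=; rewrite in_itv/= => /andP[s0 s1]; rewrite normrX lerXn2r ?nnegrE//.
  by rewrite peano_kernel_bounded// (ltW s0).
Qed.

Lemma Rintegral_peano_kernelX {R : realType} (c : R) (n : nat) :
  \int[mu]_(s in `]0, 1[) (peano_kernel c s) ^+ n =
  ((1 / 2 - c) ^+ n.+1 - (- c) ^+ n.+1) / n.+1%:R +
  (c ^+ n.+1 - (c - 1 / 2) ^+ n.+1) / n.+1%:R.
Proof.
rewrite Rintegral_oo_halves; last exact: integrable_peano_kernelX.
have -> : \int[mu]_(s in `]0, 1 / 2]) (peano_kernel c s) ^+ n =
    \int[mu]_(s in `]0, 1 / 2]) (s - c) ^+ n.
  apply: eq_Rintegral => s; rewrite inE/= in_itv/= => /andP[_ s1].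
  by rewrite /peano_kernel s1.
have -> : \int[mu]_(s in `]1 / 2, 1]) (peano_kernel c s) ^+ n =
    \int[mu]_(s in `]1 / 2, 1]) (s - (1 - c)) ^+ n.
  apply: eq_Rintegral => s; rewrite inE/= in_itv/= => /andP[s1 _].
  by rewrite /peano_kernel leNgt s1.
rewrite !Rintegral_subrX; [|lra|lra]; rewrite sub0r.
have -> : 1 - (1 - c) = c by ring.
by have -> : 1 / 2 - (1 - c) = c - 1 / 2 by field.
Qed.

(** Up to its value at 1/2, the kernel is odd about that point. *)
Lemma Rintegral_peano_kernel {R : realType} (c : R) :
  \int[mu]_(s in `]0, 1[) (peano_kernel c s) = 0.
Proof.
under eq_Rintegral do rewrite -[peano_kernel c _]expr1.
by rewrite Rintegral_peano_kernelX; field.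
Qed.

Lemma Rintegral_peano_kernel2 {R : realType} (c : R) :
  \int[mu]_(s in `]0, 1[) (peano_kernel c s) ^+ 2 = 12^-1 - c / 2 + c ^+ 2.
Proof. by rewrite Rintegral_peano_kernelX; field. Qed.

(** The Cauchy-Schwarz inequality for k and p - m, m the mean of p: since k has
    mean zero, subtracting m does not change the integral of k p. *)
Lemma Rintegral_centered_CauchySchwarz {R : realType} (D : set R) (k p : R -> R) :
  measurable D -> mu D = 1%E ->
  mu.-integrable D (EFin \o k) -> mu.-integrable D (EFin \o p) ->
  mu.-integrable D (EFin \o (fun s => k s ^+ 2)) ->
  mu.-integrable D (EFin \o (fun s => p s ^+ 2)) ->
  mu.-integrable D (EFin \o (fun s => k s * p s)) ->
  \int[mu]_(s in D) k s = 0 -> 0 < \int[mu]_(s in D) k s ^+ 2 ->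
  (\int[mu]_(s in D) (k s * p s)) ^+ 2 <=
  (\int[mu]_(s in D) k s ^+ 2) *
    (\int[mu]_(s in D) p s ^+ 2 - (\int[mu]_(s in D) p s) ^+ 2).
Proof.
move=> mD D1 ik ip ik2 ip2 ikp k0; set A := \int[mu]_(s in D) k s ^+ 2 => A0.
set B := \int[mu]_(s in D) (k s * p s); set P := \int[mu]_(s in D) p s ^+ 2.
set m := \int[mu]_(s in D) p s.
have iZ (r : R) (h : R -> R) : mu.-integrable D (EFin \o h) ->
    mu.-integrable D (EFin \o (fun s => r * h s)).
  by move=> ih; exact: (integrableZl _ r ih).
have iD (h1 h2 : R -> R) : mu.-integrable D (EFin \o h1) ->
    mu.-integrable D (EFin \o h2) ->
    mu.-integrable D (EFin \o (fun s => h1 s + h2 s)).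
  by move=> i1 i2; exact: (integrableD _ i1 i2).
have i1 : mu.-integrable D (EFin \o cst 1).
  by apply: (@integrable_bounded _ _ _ `|1|) => //; rewrite D1 ltry.
have I1 : \int[mu]_(s in D) (cst 1 s : R) = 1.
  by rewrite Rintegral_cst//= D1 mul1r.
(* B / A is the coefficient of the projection of p - m onto k; this is A ^+ 2
   times the squared norm of the residual. *)
have : 0 <= \int[mu]_(s in D) (B * k s - A * (p s - m)) ^+ 2.
  by apply: Rintegral_ge0 => s _; exact: sqr_ge0.
have -> : \int[mu]_(s in D) (B * k s - A * (p s - m)) ^+ 2 =
    \int[mu]_(s in D) (B ^+ 2 * k s ^+ 2 + (- (2 * A * B) * (k s * p s) +
      ((2 * A * B * m) * k s + (A ^+ 2 * p s ^+ 2 +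
      (- (2 * A ^+ 2 * m) * p s + (A ^+ 2 * m ^+ 2) * cst 1 s))))).
  by apply: eq_Rintegral => s _ /=; ring.
have j1 := iZ (B ^+ 2) _ ik2; have j2 := iZ (- (2 * A * B)) _ ikp.
have j3 := iZ (2 * A * B * m) _ ik; have j4 := iZ (A ^+ 2) _ ip2.
have j5 := iZ (- (2 * A ^+ 2 * m)) _ ip; have j6 := iZ (A ^+ 2 * m ^+ 2) _ i1.
have s5 := iD _ _ j5 j6; have s4 := iD _ _ j4 s5.
have s3 := iD _ _ j3 s4; have s2 := iD _ _ j2 s3.
rewrite !RintegralD//.
rewrite !RintegralZl// I1 k0 -/A -/B -/P -/m => H.
rewrite -(ler_pM2l A0) -subr_ge0; apply: (le_trans H).
by rewrite le_eqVlt; apply/orP; left; apply/eqP; ring.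
Qed.

(** * The error bound and its sharpness *)

Lemma L2P {R : realType} (a b : R) (g : R -> R) :
  L2 a b g <-> measurable_fun `]a, b[ g /\
    mu.-integrable (`]a, b[%classic : set R) (EFin \o (fun x => g x ^+ 2)).
Proof.
have sqE : EFin \o (fun x => (g \_ `]a, b[) x ^+ 2) =
    (EFin \o (fun x => g x ^+ 2)) \_ `]a, b[.
  apply/funext => x /=; rewrite !patchE; case: ifP => // _.
  by rewrite expr0n.
split=> [gL|[mg ig]].
  split.
    by apply/(measurable_restrictT _ _).2 => //; have /andP[+ _] := gL; rewrite inE.
  apply/integrable_mkcond => //; rewrite -sqE.
  exact: (Lfun2_integrable_sqr gL).
have mg' : measurable_fun setT (g \_ `]a, b[) by apply/(measurable_restrictT _ _).1.
apply/andP; rewrite !inE/=; split=> //; rewrite /finite_norm unlock/=.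
apply: poweR_lty.
have /integrable_mkcond := ig; rewrite -sqE => /(_ (measurable_itv _)).
move=> /integrableP[_]; congr (_ < _)%E; apply: eq_integral => x _ /=.
by rewrite powR_mulrn// real_normK ?num_real// ger0_norm// sqr_ge0.
Qed.

(** On a bounded interval 1 + g^2 dominates |g|. *)
Lemma L2_integrable {R : realType} (a b : R) (g : R -> R) : L2 a b g ->
  mu.-integrable (`]a, b[%classic : set R) (EFin \o g).
Proof.
move=> /L2P[mg ig2].
have i1 : mu.-integrable (`]a, b[%classic : set R) (EFin \o cst 1).
  apply: (@integrable_bounded _ _ _ `|1|) => //.
  by rewrite /= lebesgue_measure_itv/=; case: ifP => // _; rewrite -EFinB ltry.
have iS : mu.-integrable (`]a, b[%classic : set R)
    (fun x => (1 + g x ^+ 2)%:E) by exact: integrableD i1 ig2.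
apply: (le_integrable _ _ _ iS) => //; first exact/measurable_EFinP.
move=> x _ /=; rewrite lee_fin [leRHS]ger0_norm ?addr_ge0 ?sqr_ge0//.
rewrite -(real_normK (num_real (g x))); have := normr_ge0 (g x); nra.
Qed.

Lemma ae_eq_Rintegral {R : realType} (D : set R) (g h : R -> R) :
  measurable D -> measurable_fun D g -> measurable_fun D h ->
  {ae @lebesgue_measure R, forall x, x \in D -> g x = h x} ->
  \int[mu]_(x in D) g x = \int[mu]_(x in D) h x.
Proof.
move=> mD mg mh gh; congr fine; apply: ae_eq_integral => //.
- exact/measurable_EFinP.
- exact/measurable_EFinP.
- move: gh; apply: filterS; first exact: (ae_filter_ringOfSetsType mu).
  by move=> x H Dx; rewrite H// inE.
Qed.

Lemma three_point_peano {R : realType} (c : R) (f : R -> R) :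
  abs_continuous 0 1 f -> measurable_fun (`]0, 1[%classic : set R) (f^`())%classic ->
  three_point_error c f =
  - \int[mu]_(s in `]0, 1[) (peano_kernel c s * (f^`())%classic s).
Proof.
move=> fac mf'; have [g [ig gE f'E]] := abs_continuous_FTC ler01 fac.
rewrite (primitive_peano c ig gE); congr (- _).
have mK : measurable_fun (`]0, 1[%classic : set R) (peano_kernel c).
  by apply: measurable_funTS; exact: measurable_peano_kernel.
have /integrableP[/measurable_EFinP mg _] := ig.
apply: ae_eq_Rintegral => //.
- by apply: measurable_funM => //; exact: measurable_funTS.
- exact: measurable_funM.
move: f'E; apply: filterS; first exact: (ae_filter_ringOfSetsType mu).
by move=> x + x01 => ->//; move: x01; rewrite inE.
Qed.

Lemma peano_kernel_norm2_gt0 {R : realType} (c : R) : 0 < 12^-1 - c / 2 + c ^+ 2.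
Proof. by have := sqr_ge0 (c - 1 / 4); rewrite expr2; lra. Qed.

Lemma three_point_bound {R : realType} (c : R) (f : R -> R) :
  abs_continuous 0 1 f -> L2 0 1 (f^`())%classic ->
  `|three_point_error c f| <=
  Num.sqrt (12^-1 - c / 2 + c ^+ 2) * sigma 0 1 (f^`())%classic.
Proof.
move=> fac fL; have /L2P[mf' if'2] := fL; have if' := L2_integrable fL.
rewrite three_point_peano// normrN.
have iK (n : nat) : mu.-integrable (`]0, 1[%classic : set R)
    (EFin \o (fun s => peano_kernel c s ^+ n)).
  apply: integrableS (integrable_peano_kernelX c n) => //.
  by apply: subset_itvl; rewrite bnd_simp.
have mK : measurable_fun (`]0, 1[%classic : set R) (peano_kernel c).
  by apply: measurable_funTS; exact: measurable_peano_kernel.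
have iKf' : mu.-integrable (`]0, 1[%classic : set R)
    (EFin \o (fun s => peano_kernel c s * (f^`())%classic s)).
  apply: (@integrable_boundedM _ _ _ _ (1 + `|c|)) => //.
  move=> s /=; rewrite in_itv/= => /andP[s0 s1].
  by rewrite peano_kernel_bounded// !ltW.
have A0 := peano_kernel_norm2_gt0 c.
have mu1 : mu (`]0, 1[%classic : set R) = 1%E.
  by rewrite /= lebesgue_measure_itv/= lte_fin ltr01 -EFinB subr0.
rewrite /sigma /Tdiag subr0 invr1 !mul1r -sqrtrM ?(ltW A0)//.
rewrite -[leLHS]sqrtr_sqr ler_wsqrtr//.
rewrite -(Rintegral_peano_kernel2 c).
apply: Rintegral_centered_CauchySchwarz => //.
- exact: (iK 1%N).
- exact: Rintegral_peano_kernel.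
- by rewrite Rintegral_peano_kernel2.
Qed.

Lemma lipschitz_abs_continuous {R : realType} (a b M : R) (f : R -> R) :
  0 <= M ->
  (forall x y, a <= x -> x <= y -> y <= b -> `|f y - f x| <= M * (y - x)) ->
  abs_continuous a b f.
Proof.
move=> M0 fM e e0; have M1 : 0 < M + 1 by rewrite ltr_wpDl.
(* M + 1 rather than M, which may be 0. *)
exists (e / (M + 1)); first by rewrite divr_gt0.
move=> n u v uv _; rewrite ltr_pdivlMr// => suv.
apply: le_lt_trans suv; rewrite mulr_suml; apply: ler_sum => i _.
have [au [uiv vb]] := uv i; apply: (le_trans (fM _ _ au (ltW uiv) vb)).
by rewrite mulrC ler_wpM2l ?subr_ge0 ?(ltW uiv)// lerDl.
Qed.

(** A primitive of the kernel, in closed form: on either side of 1/2 it is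
    half the square of the affine function given by the kernel there, up to
    sign, and the two branches agree at 1/2. *)
Definition peano_extremal {R : realType} (c x : R) : R :=
  (`|x - 1 / 2| - (1 / 2 - c)) ^+ 2 / 2.

Lemma peano_extremal_abs_continuous {R : realType} (c : R) :
  abs_continuous 0 1 (peano_extremal c).
Proof.
apply: (@lipschitz_abs_continuous _ _ _ (1 + `|c|)).
  by rewrite addr_ge0.
move=> x y x0 xy y1; rewrite /peano_extremal.
set p := `|x - 1 / 2|; set q := `|y - 1 / 2|.
have p2 : p <= 1 / 2 by rewrite ler_norml; apply/andP; split; lra.
have q2 : q <= 1 / 2 by rewrite ler_norml; apply/andP; split; lra.
have p0 : 0 <= p by exact: normr_ge0.
have q0 : 0 <= q by exact: normr_ge0.
(* Difference of squares. *)
have -> : (q - (1 / 2 - c)) ^+ 2 / 2 - (p - (1 / 2 - c)) ^+ 2 / 2 =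
  ((p + q - 1) / 2 + c) * (q - p) by field.
rewrite normrM; apply: ler_pM => //.
  apply: (le_trans (ler_normD _ _)); rewrite lerD2r ler_norml.
  by apply/andP; split; lra.
apply: (le_trans (ler_dist_dist _ _)).
by rewrite (_ : _ - _ = y - x) ?ger0_norm ?subr_ge0//; ring.
Qed.

Lemma derive_peano_extremal {R : realType} (c x : R) : x != 1 / 2 ->
  ((peano_extremal c)^`())%classic x = peano_kernel c x.
Proof.
rewrite derive1E neq_lt /peano_kernel => /orP[x2|x2].
  rewrite (ltW x2); have [_] := is_derive_subrX c 1 x; rewrite expr1 => <-.
  apply: near_eq_derive; near=> y.
  have : y < 1 / 2 by near: y; exact: lt_nbhsl.
  by rewrite /peano_extremal => y2; rewrite ltr0_norm ?subr_lt0//; congr (_ / _); ring.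
rewrite leNgt x2/=; have [_] := is_derive_subrX (1 - c) 1 x; rewrite expr1 => <-.
apply: near_eq_derive; near=> y.
have : 1 / 2 < y by near: y; exact: lt_nbhsr.
by rewrite /peano_extremal => y2; rewrite gtr0_norm ?subr_gt0//; congr (_ / _); field.
Unshelve. all: by end_near. Qed.

Lemma ae_derive_peano_extremal {R : realType} (c : R) :
  {ae @lebesgue_measure R, forall x,
    ((peano_extremal c)^`())%classic x = peano_kernel c x}.
Proof.
exists [set 1 / 2]; split => //; first exact: lebesgue_measure_set1.
by move=> x /=; apply: contra_notP => /eqP; exact: derive_peano_extremal.
Qed.

(** The derivative is the kernel except at 1/2, where its value is irrelevant to
    measurability. *)
Lemma measurable_derive_peano_extremal {R : realType} (c : R) (D : set R) :
  measurable_fun D ((peano_extremal c)^`())%classic.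
Proof.
apply: measurable_funTS.
have -> : ((peano_extremal c)^`())%classic = fun x : R =>
    if x == 1 / 2 then ((peano_extremal c)^`())%classic (1 / 2) else peano_kernel c x.
  by apply/funext => x; case: eqVneq => [->//|]; exact: derive_peano_extremal.
apply: measurable_fun_ifT => //; first exact: measurable_fun_eqr.
exact: measurable_peano_kernel.
Qed.

Lemma peano_extremal_L2 {R : realType} (c : R) : L2 0 1 ((peano_extremal c)^`())%classic.
Proof.
apply/L2P; split; first exact: measurable_derive_peano_extremal.
pose M : R := Num.max (1 + `|c|) `|((peano_extremal c)^`())%classic (1 / 2)|.
apply: (@integrable_bounded _ _ _ (M ^+ 2)) => //.
- by rewrite /= lebesgue_measure_itv/= lte_fin ltr01 -EFinB ltry.
- by apply: measurable_funX; exact: measurable_derive_peano_extremal.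
- move=> s /=; rewrite in_itv/= => /andP[s0 s1].
  rewrite normrX lerXn2r ?nnegrE ?le_max ?addr_ge0//.
  have [->|s2] := eqVneq s (1 / 2); first by rewrite lexx orbT.
  by rewrite derive_peano_extremal// peano_kernel_bounded// ?(ltW s0) ?(ltW s1).
Qed.

(** Almost everywhere the derivative is the kernel itself, so both sides reduce
    to its mean and its squared norm. *)
Lemma peano_extremal_equality {R : realType} (c : R) :
  let A := 12^-1 - c / 2 + c ^+ 2 in
  three_point_error c (peano_extremal c) = - A
  /\ sigma 0 1 ((peano_extremal c)^`())%classic = Num.sqrt A.
Proof.
move=> A; have mf' := @measurable_derive_peano_extremal R c.
have mK : measurable_fun (`]0, 1[%classic : set R) (peano_kernel c).
  by apply: measurable_funTS; exact: measurable_peano_kernel.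
have aeE (F : R -> R -> R) :
    measurable_fun (`]0, 1[%classic : set R) (fun s => F s (((peano_extremal c)^`())%classic s)) ->
    measurable_fun (`]0, 1[%classic : set R) (fun s => F s (peano_kernel c s)) ->
    \int[mu]_(s in `]0, 1[) F s (((peano_extremal c)^`())%classic s) =
    \int[mu]_(s in `]0, 1[) F s (peano_kernel c s).
  move=> m1 m2; apply: ae_eq_Rintegral => //.
  apply: filterS (ae_derive_peano_extremal c); first exact: (ae_filter_ringOfSetsType mu).
  by move=> x ->.
split.
  rewrite three_point_peano//; last exact: peano_extremal_abs_continuous.
  rewrite (aeE (fun s y => peano_kernel c s * y)); [|exact: measurable_funM..].
  by rewrite /A -Rintegral_peano_kernel2.
rewrite /sigma /Tdiag subr0 invr1 !mul1r (aeE (fun _ y => y))// (aeE (fun _ y => y ^+ 2)).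
- by rewrite Rintegral_peano_kernel Rintegral_peano_kernel2 expr0n/= subr0.
- by apply: measurable_funX.
- exact: measurable_funX.
Qed.

Theorem theorem8 (R : realType) :
  (forall f : R -> R,
     abs_continuous 0 1 f -> L2 0 1 (f^`())%classic ->
     `|Q01 f| <= Num.sqrt (11 / 96 - Num.sqrt 2 / 16) * sigma 0 1 (f^`())%classic)
  /\
  (forall C : R, C < Num.sqrt (11 / 96 - Num.sqrt 2 / 16) ->
     ~ (forall f : R -> R,
          abs_continuous 0 1 f -> L2 0 1 (f^`())%classic ->
          `|Q01 f| <= C * sigma 0 1 (f^`())%classic)).
Proof.
pose c : R := Num.sqrt 2 / 8.
have c2 : c ^+ 2 = 1 / 32 by rewrite expr_div_n sqr_sqrtr//; field.
have AE : 11 / 96 - Num.sqrt 2 / 16 = 12^-1 - c / 2 + c ^+ 2.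
  by rewrite c2 /c; field.
have QE f : Q01 f = three_point_error c f.
  by rewrite /Q01 /three_point_error (_ : 1 - Num.sqrt 2 / 4 = 1 - 2 * c)// /c; field.
rewrite AE; split=> [f fac fL|C CA]; first by rewrite QE; exact: three_point_bound.
move=> /(_ (peano_extremal c) (peano_extremal_abs_continuous c) (peano_extremal_L2 c)).
have [Qex sigmaex] := peano_extremal_equality c; have A0 := peano_kernel_norm2_gt0 c.
rewrite QE Qex sigmaex normrN gtr0_norm// -{1}(sqr_sqrtr (ltW A0)) expr2.
by rewrite ler_pM2r ?sqrtr_gt0// leNgt CA.
Qed.
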